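(* Let $G$ be a simple connected graph with $n$ vertices and $m$ edges, let $k\ge1$ and $r\ge1$ be integers, and let $S_{2k}^r(G)$ be the $r$-th iterated $2k$-parallel subdivision graph of $G$. Write $E'_{r-1}$ and $V'_{r-1}$ for the edge and vertex sets of $S_{2k}^{r-1}(G)$ and $\Gamma(S_{2k}^{r-1}(G))$ for the multiset of normalized Laplacian eigenvalues of $S_{2k}^{r-1}(G)$. Then the multiset of normalized Laplacian eigenvalues of $S_{2k}^r(G)$ is $$g_1(\Gamma(S_{2k}^{r-1}(G))\setminus\{0,2\})\cup g_2(\Gamma(S_{2k}^{r-1}(G))\setminus\{0,2\})\cup g_3(\Gamma(S_{2k}^{r-1}(G))\setminus\{0,2\})\cup\{0,2\}\cup\{\tfrac12\}^{(k|E'_{r-1}|-|V'_{r-1}|+2)}\cup\{\tfrac32\}^{(k|E'_{r-1}|-|V'_{r-1}|+2)}$$ if $G$ is bipartite, and $$g_1(\Gamma(S_{2k}^{r-1}(G))\setminus\{0\})\cup g_2(\Gamma(S_{2k}^{r-1}(G))\setminus\{0\})\cup g_3(\Gamma(S_{2k}^{r-1}(G))\setminus\{0\})\cup\{0\}\cup\{\tfrac12\}^{(k|E'_{r-1}|-|V'_{r-1}|)}\cup\{\tfrac32\}^{(k|E'_{r-1}|-|V'_{r-1}|+2)}$$ if $G$ is non-bipartite, where $\{x\}^{(c)}$ denotes the multiset consisting of $x$ repeated $c$ times and all unions are multiset unions.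
   Context: The normalized Laplacian of a graph $H$ without isolated vertices is $I-D(H)^{-1/2}A(H)D(H)^{-1/2}$. The $2k$-parallel subdivision graph $S_{2k}(H)$ is obtained from $H$ by replacing each edge $uv$ by $k$ internally disjoint paths $u-w_1-w_2-v$ of length $3$ (each with its own two new internal vertices). Iterates: $S_{2k}^0(G)=G$, $S_{2k}^r(G)=S_{2k}(S_{2k}^{r-1}(G))$. For a real number $x$, let $g_1(x),g_2(x),g_3(x)$ denote the three roots of $4\zeta^3-12\zeta^2+9\zeta-x=0$; for a multiset $U$ of reals, $g_l(U)$ is the multiset $\bigcup_{x\in U}\{g_l(x)\}$ ($l=1,2,3$). In $\Gamma\setminus\{0,2\}$ (resp. $\Gamma\setminus\{0\}$) one copy of each listed value is removed. *)

(* Defs.v *)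
From HB Require Import structures.
From mathcomp Require Import all_boot all_order all_algebra.
Set Implicit Arguments. Unset Strict Implicit. Unset Printing Implicit Defensive.
Import Order.TTheory GRing.Theory Num.Theory.
Local Open Scope ring_scope.

Record sgraph := SGraph { sg_vtx : finType; sg_adj : rel sg_vtx }.
Arguments sg_adj : clear implicits.

Definition simple_graph (T : finType) (e : rel T) : Prop :=
  symmetric e /\ irreflexive e.

Definition connected_graph (T : finType) (e : rel T) : Prop :=
  forall x y : T, connect e x y.

Definition bipartite (T : finType) (e : rel T) : Prop :=
  exists f : T -> bool, forall x y, e x y -> f x != f y.

Definition nedges (G : sgraph) : nat :=
  (#|[set p : sg_vtx G * sg_vtx G | sg_adj G p.1 p.2]|)./2.

Definition nverts (G : sgraph) : nat := #|sg_vtx G|.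

(* The 2k-parallel subdivision S_{2k}(H).  New vertices are triples
   ((u,v), j) with uv an edge (ordered) and j < k : it is the internal
   vertex of the j-th path u - w1 - w2 - v that is adjacent to u.
   Thus the j-th path replacing {u,v} is
     u - ((u,v),j) - ((v,u),j) - v. *)
Definition sub_vtx (k : nat) (G : sgraph) : finType :=
  (sg_vtx G + ({p : sg_vtx G * sg_vtx G | sg_adj G p.1 p.2} * 'I_k))%type.

Definition sub_adj (k : nat) (G : sgraph) : rel (sub_vtx k G) :=
  fun a b =>
    match a, b with
    | inl _, inl _ => false
    | inl x, inr (p, _) => x == (val p).1
    | inr (p, _), inl y => y == (val p).1
    | inr (p, j), inr (q, j') =>
        [&& (val q).1 == (val p).2, (val q).2 == (val p).1 & j == j']
    end.

Definition subdiv (k : nat) (G : sgraph) : sgraph :=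
  SGraph (@sub_adj k G).

Fixpoint iter_subdiv (k r : nat) (G : sgraph) : sgraph :=
  match r with
  | 0 => G
  | r'.+1 => subdiv k (iter_subdiv k r' G)
  end.

Definition deg (G : sgraph) (x : sg_vtx G) : nat :=
  #|[set y | sg_adj G x y]|.

Definition nlap (C : numClosedFieldType) (G : sgraph) : 'M[C]_#|sg_vtx G| :=
  \matrix_(i, j)
    ((i == j)%:R -
     (sg_adj G (enum_val i) (enum_val j))%:R /
       (sqrtC (@deg G (enum_val i))%:R * sqrtC (@deg G (enum_val j))%:R)).

Definition nlap_spectrum (C : numClosedFieldType) (G : sgraph) (s : seq C) :
  Prop := char_poly (nlap C G) = \prod_(x <- s) ('X - x%:P).

Definition gcubic (C : numClosedFieldType) (x : C) : {poly C} :=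
  4%:P * 'X^3 - 12%:P * 'X^2 + 9%:P * 'X - x%:P.

(* the multiset {g_1(x), g_2(x), g_3(x)} of roots of gcubic x *)
Definition groots (C : numClosedFieldType) (x : C) : seq C :=
  sval (closed_field_poly_normal (gcubic x)).

Definition gunion (C : numClosedFieldType) (U : seq C) : seq C :=
  flatten [seq groots x | x <- U].

(* Main.v *)
Require Import Defs.
From HB Require Import structures.
From mathcomp Require Import all_boot all_order all_algebra.
From mathcomp Require Import perm zify ring.
Import Order.TTheory GRing.Theory Num.Theory.
Local Open Scope ring_scope.

(** Write [M = I - L] for the normalized adjacency matrix. Ordering the old
    vertices of [S_2k(H)] first, its [M] is the block matrix [0, B; B^T, D]
    where [2 D] is the permutation matrix exchanging the two inner vertices of
    every path; one has [B B^T = 1/2], [D^2 = 1/4] and [B D B^T = M(H) / 4].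
    A division-free Schur complement then gives, with [n] vertices and [m] edges
    in [H], [q = (X - 1/2) (X - 3/2)] and [g = 4 X^3 - 12 X^2 + 9 X],
    [4^n q^n chi(S_2k(H)) = q^(k m) (chi(H) o g)]. The eigenvalue [0]
    contributes the factor [g = X (2 X - 3)^2] and, in the bipartite case, [2] contributes
    [g - 2 = (X - 2) (2 X - 1)^2]. Cancelling [q^n] needs [n <= k m + 2], resp.
    [n <= k m], which a breadth-first search provides for [G] and which is
    inherited by subdivisions. *)

(** * Counting edges *)

Section EdgeCount.
Variables (T : finType) (e : rel T).
Hypotheses (sym : symmetric e) (irr : irreflexive e).

(** Swapping the ends matches the ordered pairs of increasing rank with those of decreasing rank,
    and [irr] leaves no others. So the halving in [nedges] is exact. *)
Lemma card_edges_even :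
  #|[set p : T * T | e p.1 p.2]| = (2 * #|[set p : T * T | e p.1 p.2]|./2)%N.
Proof.
pose A := [set p : T * T | e p.1 p.2 & (enum_rank p.1 < enum_rank p.2)%N].
pose B := [set p : T * T | e p.1 p.2 & (enum_rank p.2 < enum_rank p.1)%N].
have swK : cancel (fun p : T * T => (p.2, p.1)) (fun p => (p.2, p.1)) by case.
have AB : #|A| = #|B|.
  rewrite -(card_imset _ (can_inj swK)); apply: eq_card => p.
  rewrite (can2_imset_pre _ swK swK) !inE /= sym.
  by [].
have eAB : [set p : T * T | e p.1 p.2] = A :|: B.
  apply/setP=> -[x y]; rewrite !inE /= -andb_orr.
  case exy: (e x y) => //=; symmetry; rewrite -neq_ltn.
  apply/eqP=> /val_inj /enum_rank_inj exy'; by rewrite exy' irr in exy.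
have dAB : [disjoint A & B].
  rewrite disjoints_subset; apply/subsetP=> p; rewrite !inE.
  by case/andP=> -> /= /ltnW; rewrite -leqNgt.
have := cardsUI A B; rewrite -eAB (eqP (_ : A :&: B == set0)) ?setI_eq0 //.
rewrite cards0; lia.
Qed.

(* [d] is the breadth-first distance to [x0]. *)
Lemma exists_level_function (x0 : T) : connected_graph e ->
  exists d : T -> nat, forall x, x != x0 -> exists y, e y x /\ d x = (d y).+1.
Proof.
move=> conn.
pose P x n := [exists p : n.-tuple T, path e x0 p && (last x0 p == x)].
have exP x : exists n, P x n.
  have /connectP[p pp ->] := conn x0 x.
  exists (size p); apply/existsP; exists (in_tuple p); by rewrite pp eqxx.
pose d x := ex_minn (exP x).
have dle x p : path e x0 p -> last x0 p = x -> (d x <= size p)%N.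
  move=> pp lp; rewrite /d; case: ex_minnP => n _; apply.
  by apply/existsP; exists (in_tuple p); rewrite pp lp eqxx.
have dP x : exists p, [/\ path e x0 p, last x0 p = x & size p = d x].
  rewrite /d; case: ex_minnP => n /existsP[p /andP[pp /eqP lp]] _.
  by exists p; rewrite size_tuple.
exists d => x xx0.
have [p [pp lp sp]] := dP x.
case/lastP: p pp lp sp => [|p z];
  first by move=> _ /= xE; rewrite xE eqxx in xx0.
rewrite rcons_path last_rcons size_rcons => /andP[pp ez] zx sp; subst z.
exists (last x0 p); split=> //.
have [p' [pp' lp' sp']] := dP (last x0 p).
(* [h1] bounds the distance of the predecessor by [size p], one less than [d x]; extending its
   shortest path [p'] by [x] gives the reverse bound. *)
have h1 := dle _ _ pp erefl.
have : (d x <= size (rcons p' x))%N.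
  by apply: dle; rewrite ?rcons_path ?last_rcons ?pp' ?lp'.
rewrite size_rcons; lia.
Qed.

(** In a search tree every vertex but the root gives two ordered edges, to its parent and back, so
    [2 (n - 1) <= 2 m]. Without a 2-colouring some edge joins levels of equal parity, and its two
    orientations are further ordered edges. *)
Lemma connected_card_edges : connected_graph e ->
  (#|T| <= #|[set p : T * T | e p.1 p.2]|./2 + 1)%N /\
  (~ bipartite e -> (#|T| <= #|[set p : T * T | e p.1 p.2]|./2)%N).
Proof.
move=> conn.
case: (pickP (@predT T)) => [x0 _|T0]; last by rewrite (eq_card0 T0); split.
have [d hd] := exists_level_function x0 conn.
have [par hpar] : exists par : T -> T,
    forall x, x != x0 -> e (par x) x /\ d x = (d (par x)).+1.
  apply: (@fin_all_exists T (fun=> T)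
    (fun x y => x != x0 -> e y x /\ d x = (d y).+1)) => x.
  have [->|/hd[y hy]] := eqVneq x x0; [by exists x0 | by exists y].
pose E := [set p : T * T | e p.1 p.2].
(* [A1] heads one level towards the root and [A2] one level away from it; both change the parity of
   the level, so [A3] is disjoint from them. *)
pose A1 := [set p : T * T | e p.1 p.2 & (d p.1 == (d p.2).+1)].
pose A2 := [set p : T * T | e p.1 p.2 & (d p.2 == (d p.1).+1)].
pose A3 := [set p : T * T | e p.1 p.2 & (odd (d p.1) == odd (d p.2))].
have c1 : (#|T|.-1 <= #|A1|)%N.
  rewrite -(cardsC1 x0) -(card_imset _ (_ : injective (fun x => (x, par x))));
    last by move=> x y [].
  apply/subset_leq_card/subsetP=> _ /imsetP[x + ->].
  by rewrite !inE /= => /hpar [h1 h2]; rewrite sym h1 h2 eqxx.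
have c2 : (#|T|.-1 <= #|A2|)%N.
  rewrite -(cardsC1 x0) -(card_imset _ (_ : injective (fun x => (par x, x))));
    last by move=> x y [].
  apply/subset_leq_card/subsetP=> _ /imsetP[x + ->].
  by rewrite !inE /= => /hpar [h1 h2]; rewrite h1 h2 eqxx.
have cT : (0 < #|T|)%N by apply/card_gt0P; exists x0.
have cE : (#|A1| + #|A2| + #|A3| <= #|E|)%N.
  have I12 : A1 :&: A2 = set0.
    apply/setP=> p; rewrite !inE; case: (e _ _) => //=; lia.
  have I3 : (A1 :|: A2) :&: A3 = set0.
    apply/setP=> p; rewrite !inE; case: (e _ _) => //=; lia.
  have := cardsUI A1 A2; have := cardsUI (A1 :|: A2) A3.
  rewrite I12 I3 cards0 => u3 u12.
  suff: (#|A1 :|: A2 :|: A3| <= #|E|)%N by lia.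
  apply/subset_leq_card/subsetP=> p; rewrite !inE; by case: (e _ _).
have ev := card_edges_even; rewrite -/E in ev *.
split=> [|nb]; first lia.
suff : (2 <= #|A3|)%N by lia.
(* If [A3] is empty, the parity of [d] is a proper 2-colouring; otherwise an edge and its reverse
   are two members. *)
have [p|A30] := pickP [pred p | p \in A3]; last first.
  case: nb; exists (odd \o d) => x y exy /=.
  by have := A30 (x, y); rewrite !inE /= exy /= => ->.
case: p => x y; rewrite !inE /= => /andP[exy /eqP oxy].
have xy : (x, y) != (y, x).
  by apply/eqP=> -[xy _]; rewrite xy irr in exy.
apply: leq_trans (subset_leq_card (_ : [set (x, y); (y, x)] \subset A3)).
  by rewrite cards2 xy.
by apply/subsetP=> p; rewrite !inE => /orP[] /eqP -> /=;
  rewrite ?[e y x]sym exy oxy eqxx.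
Qed.
End EdgeCount.

(** * Determinants *)

(** Two enumerations of a type differ by one permutation applied to both rows and columns, so the
    signs cancel. This allows the vertices of a sum type to be listed block by block. *)
Lemma det_reindex {R : comNzRingType} {T : finType} {n1 n2}
    (g : 'I_n1 -> T) (h : 'I_n2 -> T) (f : T -> T -> R) :
  bijective g -> bijective h ->
  \det (\matrix_(i, j) f (g i) (g j)) = \det (\matrix_(i, j) f (h i) (h j)).
Proof.
move=> bg bh.
have e1 : n1 = n2.
  by rewrite -[n1]card_ord -[n2]card_ord (bij_eq_card bg) (bij_eq_card bh).
subst n2; case: bg => g' gK g'K.
have inj : injective (g' \o h) by apply: inj_comp (bij_inj bh); exact: can_inj g'K.
pose s := perm inj.
have -> : \matrix_(i, j) f (h i) (h j) =
          row_perm s (col_perm s (\matrix_(i, j) f (g i) (g j))).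
  by apply/matrixP=> i j; rewrite !mxE !permE /= !g'K.
rewrite row_permE col_permE !det_mulmx !det_perm mulrCA.
by rewrite -signr_addb odd_permV addbb mulr1.
Qed.

Lemma pencil_mul_conj {R : comNzRingType} N (t c : R) (D : 'M[R]_N) :
  D *m D = c%:M -> (t%:M + D) *m (t%:M - D) = (t ^+ 2 - c)%:M.
Proof.
move=> DD; rewrite mulmxDl !mulmxBr DD -scalar_mxM scalar_mxC.
by rewrite addrA subrK -raddfB /= expr2.
Qed.

(** Since [(t + D) (t - D) = t ^+ 2 - c], right multiplication by a block triangular matrix with
    diagonal blocks [t ^+ 2 - c] and [1] clears the lower left block without inverting [t + D]. It
    therefore applies to polynomial entries. *)
Lemma det_block_schur {R : comNzRingType} n N (t c : R)
    (B : 'M[R]_(n, N)) (D : 'M[R]_N) :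
  D *m D = c%:M ->
  \det (block_mx t%:M B B^T (t%:M + D)) * (t ^+ 2 - c) ^+ n =
  \det ((t * (t ^+ 2 - c))%:M - t *: (B *m B^T) + B *m D *m B^T)
    * \det (t%:M + D).
Proof.
move=> DD; set q := t ^+ 2 - c.
have <- : \det (block_mx q%:M 0 (- ((t%:M - D) *m B^T)) (1%:M : 'M_N)) = q ^+ n.
  by rewrite det_lblock det_scalar det1 mulr1.
rewrite -det_mulmx mulmx_block !mulmx0 !mulmx1 !add0r.
have -> : B^T *m q%:M + (t%:M + D) *m (- ((t%:M - D) *m B^T)) = 0.
  by rewrite mulmxN mulmxA (pencil_mul_conj _ t _ _ DD) scalar_mxC subrr.
rewrite det_ublock; congr (\det _ * _).
rewrite mulmxN mulmxBl mulmxBr [t%:M *m B^T]mul_scalar_mx -scalemxAr mulmxA.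
by rewrite opprB -scalar_mxM addrA addrAC.
Qed.

(* Conjugation by the sign matrix S turns t + D into t - D. *)
Lemma det_sq_pencil {R : comNzRingType} N (t c : R) (D S : 'M[R]_N) :
  D *m D = c%:M -> S *m S = 1%:M -> S *m D *m S = - D ->
  \det (t%:M + D) ^+ 2 = (t ^+ 2 - c) ^+ N.
Proof.
move=> DD SS SDS.
have dS : \det S * \det S = 1 by rewrite -det_mulmx SS det1.
have e : \det (t%:M - D) = \det (t%:M + D).
  have -> : t%:M - D = S *m (t%:M + D) *m S.
    by rewrite mulmxDr mulmxDl SDS scalar_mxC -mulmxA SS mulmx1.
  by rewrite !det_mulmx mulrAC dS mul1r.
rewrite expr2 -[X in _ * X]e -det_mulmx.
by rewrite (pencil_mul_conj _ t _ _ DD) det_scalar.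
Qed.

Lemma sqrtC_mulr (C : numClosedFieldType) (x : C) : sqrtC x * sqrtC x = x.
Proof. by rewrite -expr2 sqrtCK. Qed.

Lemma sum_enum_val (R : nmodType) (T : finType) (F : T -> R) :
  \sum_(a < #|T|) F (enum_val a) = \sum_(x : T) F x.
Proof. by rewrite -(big_enum_val F); apply: eq_bigl. Qed.

Lemma sum_nat_bool (R : pzSemiRingType) (T : finType) (P : pred T) :
  \sum_(x : T) (P x)%:R = #|[set x | P x]|%:R :> R.
Proof.
rewrite -sum1_card natr_sum [RHS]big_mkcond /=.
by apply: eq_bigr => x _; rewrite inE; case: (P x).
Qed.

(** Fixes the sign of a determinant known only through its square. *)
Lemma monic_sqr_inj (R : numDomainType) (p q : {poly R}) :
  p \is monic -> q \is monic -> p ^+ 2 = q ^+ 2 -> p = q.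
Proof.
move=> /monicP mp /monicP mq /eqP; rewrite eqf_sqr => /orP[/eqP //|/eqP pq].
have := mp; rewrite pq lead_coefN mq => /eqP.
by rewrite eq_sym -addr_eq0 -mulr2n pnatr_eq0.
Qed.

(** The roots are [1 - 1/2] and [1 + 1/2]; the right side is the form [t ^+ 2 - c] met in the Schur
    complement, with [t = 'X - 1]. *)
Lemma mul_XsubC_halves (R : numFieldType) :
  ('X - (2%:R^-1)%:P) * ('X - (3%:R / 2%:R)%:P) =
  ('X - 1) ^+ 2 - (4%:R^-1)%:P :> {poly R}.
Proof.
have -> : (4%:R^-1)%:P = (2%:R^-1)%:P ^+ 2 :> {poly R}.
  by rewrite -polyC_exp; congr (_%:P); field.
have -> : (3%:R / 2%:R)%:P = 1 + (2%:R^-1)%:P :> {poly R}.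
  by rewrite -polyC1 -polyCD; congr (_%:P); field.
have : 1 = (2%:R^-1)%:P *+ 2 :> {poly R}.
  by rewrite -polyCMn -polyC1; congr (_%:P); field.
by set h := _%:P => ->; ring.
Qed.

(** * The characteristic polynomial of a subdivision *)

Section Subdivision.
Variables (C : numClosedFieldType) (k : nat) (G : sgraph).
Hypotheses (symG : symmetric (sg_adj G)) (irrG : irreflexive (sg_adj G)).
Hypotheses (k_gt0 : (0 < k)%N) (degG : forall x : sg_vtx G, (0 < deg x)%N).
Local Notation V := (sg_vtx G).
Local Notation W := ({p : V * V | sg_adj G p.1 p.2} * 'I_k)%type.
Local Notation SG := (subdiv k G).

Lemma card_new_vertices (P : pred (V * V)) :
  #|[set w : W | P (val w.1)]| =
  (k * #|[set p : V * V | sg_adj G p.1 p.2 & P p]|)%N.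
Proof.
have -> : [set w : W | P (val w.1)] = setX [set a | P (val a)] setT.
  by apply/setP=> w; rewrite !inE andbT.
rewrite cardsX cardsT card_ord mulnC; congr (_ * _)%N.
rewrite -(card_imset _ val_inj); apply: eq_card => p; rewrite !inE.
apply/imsetP/andP => [[a + ->]|[ep Pp]]; first by rewrite inE (valP a).
by exists (exist _ p ep); rewrite ?inE.
Qed.

(** The new vertex at the other end of the middle edge of the same path. *)
Definition flip (w : W) : W :=
  (exist (fun p : V * V => sg_adj G p.1 p.2) ((val w.1).2, (val w.1).1)
     (etrans (symG _ _) (valP w.1)), w.2).

Lemma flipK : involutive flip.
Proof. by move=> [[[x y] exy] j]; congr (_, _); apply: val_inj. Qed.

Lemma sub_adj_flip (w w' : W) :
  sub_adj (inr w : sub_vtx k G) (inr w') = (w' == flip w).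
Proof.
case: w w' => [p j] [[[x y] exy] j'] /=.
apply/and3P/eqP => [[/eqP h1 /eqP h2 /eqP ->]|[-> -> ->]]; last by rewrite !eqxx.
by congr (_, _); apply: val_inj; rewrite /= -h1 -h2.
Qed.

Lemma card_out_edges u :
  #|[set p : V * V | sg_adj G p.1 p.2 & u == p.1]| = deg u.
Proof.
rewrite /deg -[RHS](card_imset _ (_ : injective (pair u))); last by move=> ? ? [].
apply: eq_card => -[x y]; rewrite !inE /=.
apply/andP/imsetP => [[exy /eqP->]|[z + [-> ->]]]; last by rewrite inE.
by exists y; rewrite ?inE.
Qed.

Lemma deg_old u : deg (inl u : sg_vtx SG) = (k * deg u)%N.
Proof.
rewrite {1}/deg.
have -> : [set y : sg_vtx SG | sg_adj SG (inl u) y] =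
   inr @: [set w : W | u == (val w.1).1].
  apply/setP=> -[x|w]; rewrite !inE /=.
    by apply/esym/imsetP=> -[].
  by rewrite mem_imset ?inE //; [case: w | move=> ? ? []].
rewrite card_imset; last by move=> ? ? [].
by rewrite (card_new_vertices (fun p => u == p.1)) card_out_edges.
Qed.

Lemma deg_new w : deg (inr w : sg_vtx SG) = 2%N.
Proof.
rewrite /deg.
have -> : [set y : sg_vtx SG | sg_adj SG (inr w) y] =
   [set inl (val w.1).1; inr (flip w)].
  apply/setP=> -[x|w']; rewrite !inE.
    by case: w => p j /=; rewrite orbF; apply/eqP/eqP => [->|[->]].
  by rewrite [LHS](sub_adj_flip w w'); apply/eqP/eqP => [->|[]].
by rewrite cards2.
Qed.

(** The block [B] of the normalized adjacency matrix; [k * deg] and [2] are the degrees of old and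
    new vertices in the subdivision. *)
Definition old_new_mx : 'M[C]_(#|V|, #|{: W}|) := \matrix_(i, a)
  ((enum_val i == (val (enum_val a).1).1)%:R /
   (sqrtC (k * deg (enum_val i))%:R * sqrtC 2%:R)).

Definition flip_mx : 'M[C]_#|{: W}| := \matrix_(a, b)
  ((enum_val b == flip (enum_val a))%:R / 2%:R).

(** As [L = 1 - M], the matrix [X - L] equals [(X - 1) + M], so the blocks of [M] enter with a plus
    sign. *)
Lemma char_poly_subdiv_block :
  char_poly (nlap C SG) =
  \det (block_mx ('X - 1)%:M (map_mx polyC old_new_mx)
       (map_mx polyC old_new_mx)^T (('X - 1)%:M + map_mx polyC flip_mx)).
Proof.
(* The entries of [X - L] as a function of vertices, so that [det_reindex] can put the old vertices
   first. *)
pose F (a b : sg_vtx SG) : {poly C} := ('X - 1) *+ (a == b) +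
  ((sg_adj SG a b)%:R / (sqrtC (deg a)%:R * sqrtC (deg b)%:R))%:P.
have -> : char_poly (nlap C SG) =
    \det (\matrix_(i < #|sg_vtx SG|, j < #|sg_vtx SG|)
             F (enum_val i) (enum_val j)).
  congr (\det _); apply/matrixP=> i j; rewrite !mxE /F (inj_eq enum_val_inj).
  rewrite polyCB opprB addrCA addrC.
  by case: (i == j); rewrite /= ?mulr1n ?mulr0n ?polyC1 ?polyC0 ?subr0 // addrC.
pose h (i : 'I_(#|V| + #|{: W}|)) : sg_vtx SG :=
  match split i with inl a => inl (enum_val a) | inr b => inr (enum_val b) end.
pose h' (x : sg_vtx SG) : 'I_(#|V| + #|{: W}|) :=
  match x with inl u => lshift _ (enum_rank u) | inr w => rshift _ (enum_rank w) end.
have bh : bijective h.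
  exists h' => [i|x]; rewrite /h /h'.
    by case: splitP => j ij; apply: val_inj; rewrite /= enum_valK ij.
  case: x => x; first by rewrite (unsplitK (inl _)) enum_rankK.
  by rewrite (unsplitK (inr _)) enum_rankK.
rewrite (det_reindex _ _ F (enum_val_bij _) bh); congr (\det _).
have hl a : h (lshift _ a) = inl (enum_val a) by rewrite /h (unsplitK (inl _)).
have hr a : h (rshift _ a) = inr (enum_val a) by rewrite /h (unsplitK (inr _)).
rewrite -[LHS]submxK; congr block_mx; apply/matrixP=> a b; rewrite !mxE ?hl ?hr /F.
- by rewrite mul0r addr0 (inj_eq (@inl_inj _ _)) (inj_eq enum_val_inj).
- rewrite deg_old deg_new mulr0n add0r; congr ((_%:R / _)%:P).
  by rewrite /=; case: (enum_val b).
- rewrite deg_old deg_new mulr0n add0r [sqrtC _ * _]mulrC; congr ((_%:R / _)%:P).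
  by rewrite /=; case: (enum_val a).
- rewrite !deg_new sqrtC_mulr (inj_eq (@inr_inj _ _)) (inj_eq enum_val_inj).
  by rewrite -sub_adj_flip.
Qed.

(** A new vertex has a single old neighbour, so distinct rows have disjoint supports; the row of [u]
    has [k * deg u] nonzero entries, each of square [1 / (2 k deg u)]. *)
Lemma old_new_mx_mul_tr : old_new_mx *m old_new_mx^T = (2%:R^-1)%:M.
Proof.
apply/matrixP=> i j; rewrite !mxE.
pose x := enum_val i; pose y := enum_val j.
pose c := (sqrtC (k * deg x)%:R * sqrtC 2%:R)^-1 : C.
pose c' := (sqrtC (k * deg y)%:R * sqrtC 2%:R)^-1 : C.
transitivity (\sum_(w : W) (c * c' * (x == y)%:R) * (x == (val w.1).1)%:R).
  rewrite -[RHS]sum_enum_val; apply: eq_bigr => a _; rewrite !mxE -/x -/y -/c -/c'.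
  case: (eqVneq x (val (enum_val a).1).1) => [<-|_]; rewrite ?mul0r ?mulr0 //.
  by rewrite mul1r mulr1 eq_sym -mulrA [c' * _]mulrC.
rewrite -mulr_sumr sum_nat_bool (card_new_vertices (fun p => x == p.1)).
rewrite card_out_edges.
have [xy|xy] := eqVneq x y; last first.
  rewrite mulr0 mul0r; case: (eqVneq i j) => // ij.
  by rewrite /x /y ij eqxx in xy.
have ij := enum_val_inj xy; rewrite ij eqxx mulr1n mulr1 /c /c' -xy.
rewrite -invfM mulrACA !sqrtC_mulr invfM mulrAC mulVf ?mul1r //.
by rewrite pnatr_eq0 -lt0n muln_gt0 k_gt0 degG.
Qed.

Lemma flip_mx_sq : flip_mx *m flip_mx = (4%:R^-1)%:M.
Proof.
apply/matrixP=> i j; rewrite !mxE.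
transitivity (\sum_(w : W)
  ((w == flip (enum_val i))%:R / 2%:R * ((enum_val j == flip w)%:R / 2%:R)) : C).
  by rewrite -[RHS]sum_enum_val; apply: eq_bigr => a _; rewrite !mxE.
rewrite (bigD1 (flip (enum_val i))) //= big1 => [|w /negbTE ->];
  last by rewrite !mul0r.
rewrite eqxx flipK (inj_eq enum_val_inj) eq_sym addr0 mulrACA mul1r -invfM -natrM.
by case: (i == j); rewrite ?mul1r ?mul0r.
Qed.

(** The entry at [x, y] sums over the [k] paths that replace the edge from [x] to [y], if there is
    one. Each weighs [1 / (4 k sqrt (deg x deg y))], so [k] cancels. *)
Lemma old_flip_old_mx :
  old_new_mx *m flip_mx *m old_new_mx^T = 4%:R^-1 *: (1%:M - nlap C G).
Proof.
apply/matrixP=> i j; rewrite !mxE.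
pose x := enum_val i; pose y := enum_val j.
pose c := (sqrtC (k * deg x)%:R * sqrtC 2%:R)^-1 : C.
pose c' := (sqrtC (k * deg y)%:R * sqrtC 2%:R)^-1 : C.
(* A pair [v], [w] contributes only when [w = flip v], [v] is attached to [x] and [w] to [y], that
   is when [v] belongs to the ordered edge [(x, y)]. *)
transitivity (\sum_(w : W) (c * c' * 2%:R^-1) * ((val w.1) == (x, y))%:R).
  transitivity (\sum_(w : W)
      (\sum_(v : W) (x == (val v.1).1)%:R * c * ((w == flip v)%:R / 2%:R)) *
      ((y == (val w.1).1)%:R * c')).
    rewrite -[RHS]sum_enum_val; apply: eq_bigr => a _; rewrite !mxE -/x -/y -/c -/c'.
    congr (_ * _); rewrite -[RHS]sum_enum_val; apply: eq_bigr => b _.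
    by rewrite !mxE.
  under eq_bigr => w _ do rewrite mulr_suml.
  rewrite exchange_big /=; apply: eq_bigr => v _.
  rewrite (bigD1 (flip v)) //= big1 => [|w /negbTE ->];
    last by rewrite mul0r mulr0 mul0r.
  rewrite eqxx addr0 -pair_eqE /= [x == _]eq_sym [y == _]eq_sym.
  by case: (_ == x); case: (_ == y); rewrite /= ?mulr0 ?mul0r ?mulr0 //; ring.
rewrite -mulr_sumr sum_nat_bool (card_new_vertices (fun p => p == (x, y))).
have -> : #|[set p : V * V | sg_adj G p.1 p.2 & p == (x, y)]| = sg_adj G x y.
  case exy: (sg_adj G x y).
    transitivity #|[set (x, y)]|; last by rewrite cards1.
    apply: eq_card => p; rewrite !inE.
    by case: eqP => [->|]; rewrite ?andbF ?andbT.
  by apply: eq_card0 => p; rewrite !inE; case: eqP => [->|]; rewrite ?andbF ?andbT.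
rewrite opprB addrCA subrr addr0 -/x -/y /c /c' !natrM !sqrtCM ?nnegrE ?ler0n //.
set a := sqrtC (deg x)%:R; set b := sqrtC (deg y)%:R.
rewrite -invfM !mulrA.
have k0 : k%:R != 0 :> C by rewrite pnatr_eq0 -lt0n.
have -> : sqrtC k%:R * a * sqrtC 2%:R * sqrtC k%:R * b * sqrtC 2%:R =
   (sqrtC k%:R * sqrtC k%:R) * (sqrtC 2%:R * sqrtC 2%:R) * (a * b) :> C by ring.
rewrite !sqrtC_mulr.
have a0 : a != 0 by rewrite sqrtC_eq0 pnatr_eq0 -lt0n.
have b0 : b != 0 by rewrite sqrtC_eq0 pnatr_eq0 -lt0n.
by field; rewrite k0 a0 b0.
Qed.

Lemma card_new_even : #|{: W}| = (2 * (k * nedges G))%N.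
Proof.
rewrite -cardsT.
have -> : [set: W] = [set w : W | predT (val w.1)] by apply/setP=> w; rewrite !inE.
rewrite (card_new_vertices predT) mulnCA; congr (_ * _)%N.
rewrite -(card_edges_even _ _ symG irrG); apply: eq_card => p.
by rewrite !inE andbT.
Qed.

(** There are [2 k m] new vertices, so [det_sq_pencil] yields the square of the claim; both sides
    are monic. *)
Lemma det_flip_pencil :
  \det (('X - 1)%:M + map_mx polyC flip_mx) =
  (('X - (2%:R^-1)%:P) * ('X - (3%:R / 2%:R)%:P)) ^+ (k * nedges G) :> {poly C}.
Proof.
have mE : ('X - 1)%:M + map_mx polyC flip_mx = char_poly_mx (1%:M - flip_mx).
  rewrite /char_poly_mx map_mxB map_scalar_mx /= polyC1 opprB addrA addrAC.
  by rewrite -raddfB.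
apply: monic_sqr_inj; first by rewrite mE char_poly_monic.
  by rewrite monic_exp // monicMl ?monicXsubC.
rewrite -exprM mulnC -card_new_even.
(* The signs come from orienting every edge by the order of its end points. *)
pose s (w : W) : C := (-1) ^+ (enum_rank (val w.1).1 < enum_rank (val w.1).2)%N.
pose S := diag_mx (\row_(j < #|{: W}|) s (enum_val j)).
rewrite (@det_sq_pencil _ _ _ (4%:R^-1)%:P _ (map_mx polyC S)) ?mul_XsubC_halves //.
- by rewrite -map_mxM flip_mx_sq map_scalar_mx.
- rewrite -map_mxM mulmx_diag -polyC1 -map_scalar_mx; congr (map_mx _ _).
  by apply/matrixP=> i j; rewrite !mxE -expr2 sqrr_sign.
- rewrite -!map_mxM -map_mxN; congr (map_mx _ _).
  apply/matrixP=> i j; rewrite mul_mx_diag mul_diag_mx !mxE.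
  case: eqP => [->|_]; rewrite ?mul0r ?mulr0 ?mul0r ?oppr0 //.
  have e : s (enum_val i) * s (flip (enum_val i)) = -1.
    rewrite /s /=; move: (enum_val i) => [[[x y] exy] l] /=.
    rewrite -signr_addb.
    have : enum_rank x != enum_rank y :> nat.
      by apply/eqP=> /val_inj/enum_rank_inj xy; move: exy; rewrite /= xy irrG.
    by case: ltngtP.
  by rewrite mul1r mulrAC e mulN1r.
Qed.

(** With [t = X - 1] the Schur complement is [t^3 - 3 t / 4 + (1 - L) / 4]. Four times it is
    [g - L], because [g = 4 t^3 - 3 t + 1], which is one plus the cubic Chebyshev polynomial in
    [t]. *)
Lemma char_poly_subdiv :
  char_poly (nlap C SG) *
    (('X - (2%:R^-1)%:P) * ('X - (3%:R / 2%:R)%:P)) ^+ nverts G * 4%:R ^+ nverts G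
  = (char_poly (nlap C G) \Po (4%:P * 'X^3 - 12%:P * 'X^2 + 9%:P * 'X)) *
    (('X - (2%:R^-1)%:P) * ('X - (3%:R / 2%:R)%:P)) ^+ (k * nedges G).
Proof.
rewrite -det_flip_pencil char_poly_subdiv_block mul_XsubC_halves.
rewrite /nverts det_block_schur; last by rewrite -map_mxM flip_mx_sq map_scalar_mx.
rewrite mulrAC; congr (_ * _).
rewrite map_trmx -!map_mxM old_new_mx_mul_tr old_flip_old_mx.
rewrite map_mxZ map_mxB !map_scalar_mx.
rewrite mulrC -detZ -det_map_mx; congr (\det _).
apply/matrixP=> i j; rewrite !mxE /= comp_polyB comp_polyC.
set l := (X in _ = _ - X).
have -> : (2%:R^-1)%:P = 2%:R * (4%:R^-1)%:P :> {poly C}.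
  by rewrite -polyC_natr -polyCM; congr (_%:P); field.
have : 4%:R * (4%:R^-1)%:P = 1 :> {poly C}.
  by rewrite -polyC_natr -polyCM -polyC1; congr (_%:P); field.
rewrite -/l polyC1 !polyC_natr; move: (4%:R^-1)%:P => h h4.
case: (i == j); rewrite ?mulr1n ?mulr0n ?comp_polyX ?comp_poly0.
  (* The inverse [h] of 4 is a variable here; collecting its terms leaves it only in [4 h], which
     [h4] replaces by 1. *)
  transitivity (4%:R * ('X - 1) ^+ 3 + 4%:R * h * (1 - l - 3%:R * ('X - 1)));
    first ring.
  by rewrite h4; ring.
by rewrite mulr0 subr0 !add0r mulrA h4 mul1r.
Qed.
End Subdivision.

(** * Structure, colourings and counts of subdivisions; the eigenvalues 0 and 2 *)

Lemma subdiv_sym k G : symmetric (sg_adj (subdiv k G)).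
Proof.
move=> [x|[p j]] [y|[q l]] //=.
by rewrite [(val p).1 == _]eq_sym [(val p).2 == _]eq_sym [l == _]eq_sym andbCA.
Qed.

Lemma subdiv_irr k G : irreflexive (sg_adj G) -> irreflexive (sg_adj (subdiv k G)).
Proof.
move=> irrG [x|[[[x y] exy] j]] //=.
by case: eqP => // xy; move: exy; rewrite /= xy irrG.
Qed.

Lemma subdiv_deg_gt0 k G : (0 < k)%N -> symmetric (sg_adj G) ->
  (forall x : sg_vtx G, (0 < deg x)%N) ->
  forall x : sg_vtx (subdiv k G), (0 < deg x)%N.
Proof.
move=> k0 symG dG [u|w]; last by rewrite deg_new.
by rewrite deg_old muln_gt0 k0 dG.
Qed.

(** Paths of odd length preserve 2-colourings: with each new vertex coloured opposite to its old
    neighbour, the middle edge is proper because the ends of the old edge differ. *)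
Lemma subdiv_bipartite k G :
  bipartite (sg_adj G) -> bipartite (sg_adj (subdiv k G)).
Proof.
case=> f hf; exists (fun a : sg_vtx (subdiv k G) =>
  match a with inl x => f x | inr w => ~~ f (val w.1).1 end).
move=> [x|[p j]] [y|[q l]] //=.
- by move/eqP=> ->; case: (f _).
- by move/eqP=> ->; case: (f _).
- case/and3P=> /eqP -> _ _; have := hf _ _ (valP p).
  by case: (f _) (f _) => -[].
Qed.

Lemma sum_deg G : #|[set p : sg_vtx G * sg_vtx G | sg_adj G p.1 p.2]| =
  (\sum_(x : sg_vtx G) deg x)%N.
Proof.
rewrite -sum1_card.
under [RHS]eq_bigr => x _ do rewrite /deg -sum1_card.
by rewrite pair_big_dep; apply: eq_bigl => p; rewrite !inE.
Qed.

Lemma nverts_subdiv k G : symmetric (sg_adj G) -> irreflexive (sg_adj G) ->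
  nverts (subdiv k G) = (nverts G + 2 * (k * nedges G))%N.
Proof. by move=> symG irrG; rewrite /nverts card_sum card_new_even. Qed.

(** The degrees sum to [2 k m] over the old vertices and to [4 k m] over the new ones. *)
Lemma nedges_subdiv k G : symmetric (sg_adj G) -> irreflexive (sg_adj G) ->
  nedges (subdiv k G) = (3 * (k * nedges G))%N.
Proof.
move=> symG irrG.
have := sum_deg (subdiv k G).
rewrite big_sumType /=.
under eq_bigr do rewrite deg_old.
under [X in (_ + X)%N]eq_bigr do rewrite (deg_new _ _ symG).
rewrite -big_distrr /= -sum_deg (card_edges_even _ _ symG irrG) sum_nat_const.
rewrite (card_new_even _ _ symG irrG) /nedges => ->; lia.
Qed.

(** Rescaling [f] by the square roots of the degrees gives an eigenvector. A constant [f] with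
    [c = 1] produces the eigenvalue 0, the signs of a 2-colouring with [c = -1] the eigenvalue 2. *)
Lemma root_char_poly_nlap (C : numClosedFieldType) G (f : sg_vtx G -> C) (c : C) :
  symmetric (sg_adj G) -> (forall x : sg_vtx G, (0 < deg x)%N) ->
  (0 < nverts G)%N -> (forall x, f x != 0) ->
  (forall x y, sg_adj G x y -> f x = c * f y) ->
  root (char_poly (nlap C G)) (1 - c).
Proof.
move=> symG dG n0 f0 hf; rewrite -eigenvalue_root_char; apply/eigenvalueP.
pose s (x : sg_vtx G) : C := sqrtC (deg x)%:R.
have s0 x : s x != 0 by rewrite sqrtC_eq0 pnatr_eq0 -lt0n.
exists (\row_j (f (enum_val j) * s (enum_val j))); last first.
  apply/eqP=> /rowP /(_ (Ordinal n0)) /eqP.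
  by rewrite !mxE mulf_eq0 (negbTE (f0 _)) (negbTE (s0 _)).
apply/rowP=> j; rewrite !mxE; set y := enum_val j.
(* By [hf] all [deg y] neighbours of [y] contribute the same term, and [deg y] is the square of
   [s y]. *)
transitivity (\sum_(x : sg_vtx G) (f x * s x * (x == y)%:R
    - (sg_adj G y x)%:R * (c * f y / s y))).
  rewrite -[RHS]sum_enum_val; apply: eq_bigr => i _; rewrite !mxE -/y -/(s _) -/(s y).
  rewrite (inj_eq enum_val_inj) mulrBr symG; congr (_ - _).
  case exy: (sg_adj G _ _); last by rewrite !mul0r mulr0.
  rewrite -(hf (enum_val i)) 1?symG //; field; by rewrite !s0.
rewrite sumrB -mulr_suml sum_nat_bool -/(deg y) (bigD1 y) //= eqxx mulr1.
rewrite big1 => [|x /negbTE ->]; last by rewrite mulr0.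
have -> : (deg y)%:R = s y * s y by rewrite sqrtC_mulr.
by rewrite addr0; field.
Qed.

(** * The cubic and its factorizations at 0 and 2 *)

Section Cubic.
Variable C : numClosedFieldType.
Implicit Types (x : C) (s : seq C).

Lemma lead_coef_gcubic x : lead_coef (gcubic x) = 4%:R.
Proof.
rewrite /gcubic -!addrA lead_coefDl.
  by rewrite mul_polyC lead_coefZ lead_coefXn mulr1.
rewrite !mul_polyC size_scale ?pnatr_eq0 // size_polyXn ltnS.
rewrite -scaleNr; apply: (leq_trans (size_polyD _ _)); rewrite geq_max.
rewrite (leq_trans (size_scale_leq _ _)) ?size_polyXn //=.
apply: (leq_trans (size_polyD _ _)); rewrite geq_max.
rewrite (leq_trans (size_scale_leq _ _)) ?size_polyX //=.
by rewrite size_polyN (leq_trans (size_polyC_leq1 _)).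
Qed.

Lemma prod_groots x :
  4%:R * \prod_(z <- groots x) ('X - z%:P) = gcubic x.
Proof.
rewrite /groots; case: closed_field_poly_normal => r /= e.
by rewrite [RHS]e lead_coef_gcubic -mul_polyC polyC_natr.
Qed.

Lemma prod_gunion_cons x s :
  \prod_(z <- gunion (x :: s)) ('X - z%:P) =
  \prod_(z <- groots x) ('X - z%:P) * \prod_(z <- gunion s) ('X - z%:P).
Proof. by rewrite /gunion /= big_cat. Qed.

Lemma prod_gunion s :
  4%:R ^+ size s * \prod_(z <- gunion s) ('X - z%:P) =
  \prod_(x <- s) gcubic x.
Proof.
elim: s => [|x s IH]; first by rewrite /gunion !big_nil mulr1.
by rewrite prod_gunion_cons big_cons -IH -prod_groots exprS mulrACA.
Qed.

Lemma prod_groots0 : \prod_(z <- groots (0 : C)) ('X - z%:P) =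
  'X * ('X - (3%:R / 2%:R)%:P) ^+ 2.
Proof.
apply: (@mulfI _ (4%:R : {poly C})).
  by rewrite -polyC_natr polyC_eq0 pnatr_eq0.
rewrite prod_groots /gcubic !polyC_natr polyC0.
have : 2%:R * (3%:R / 2%:R)%:P = 3%:R :> {poly C}.
  by rewrite -!polyC_natr -polyCM; congr (_%:P); field.
move: (3%:R / 2%:R)%:P => h h2.
(* Absorbing the factor 4 into the square leaves [h] only in [2 h], which [h2] evaluates. *)
transitivity ('X * (2%:R * 'X - 2%:R * h) ^+ 2); last ring.
by rewrite h2; ring.
Qed.

Lemma prod_groots2 : \prod_(z <- groots (2%:R : C)) ('X - z%:P) =
  ('X - 2%:P) * ('X - (2%:R^-1)%:P) ^+ 2.
Proof.
apply: (@mulfI _ (4%:R : {poly C})).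
  by rewrite -polyC_natr polyC_eq0 pnatr_eq0.
rewrite prod_groots /gcubic !polyC_natr.
have : 2%:R * (2%:R^-1)%:P = 1 :> {poly C}.
  by rewrite -!polyC_natr -polyCM -polyC1; congr (_%:P); field.
move: (2%:R^-1)%:P => h h2.
transitivity (('X - 2%:R) * (2%:R * 'X - 2%:R * h) ^+ 2); last ring.
by rewrite h2; ring.
Qed.

End Cubic.

(** * From characteristic polynomials to multisets of eigenvalues *)

(** There are as many eigenvalues as vertices and each cubic has leading coefficient 4, so the
    powers of 4 on both sides cancel. *)
Lemma char_poly_subdiv_spectrum (C : numClosedFieldType) k G (s : seq C) :
  symmetric (sg_adj G) -> irreflexive (sg_adj G) -> (0 < k)%N ->
  (forall x : sg_vtx G, (0 < deg x)%N) -> nlap_spectrum G s ->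
  char_poly (nlap C (subdiv k G)) *
    (('X - (2%:R^-1)%:P) * ('X - (3%:R / 2%:R)%:P)) ^+ nverts G =
  \prod_(z <- gunion s) ('X - z%:P) *
    (('X - (2%:R^-1)%:P) * ('X - (3%:R / 2%:R)%:P)) ^+ (k * nedges G).
Proof.
move=> symG irrG k0 dG hs.
have sz : size s = nverts G.
  have := size_char_poly (nlap C G); rewrite hs size_prod_XsubC => -[->].
  by rewrite /nverts.
apply: (@mulIf _ (4%:R ^+ nverts G : {poly C})).
  by rewrite expf_neq0 // -polyC_natr polyC_eq0 pnatr_eq0.
rewrite char_poly_subdiv // hs rmorph_prod /= [RHS]mulrC [RHS]mulrA -sz prod_gunion.
congr (_ * _); apply: eq_bigr => x _.
by rewrite comp_polyB comp_polyX comp_polyC.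
Qed.

(** The bound propagates by [n + 2 k m <= 3 k m + c <= k (3 k m) + c]. The slack [c] is 2 in the
    bipartite case and 0 in the other, so edges need comparing with vertices only in the initial
    graph. *)
Lemma iter_subdiv_invariants k r G (c : nat) : (0 < k)%N ->
  symmetric (sg_adj G) -> irreflexive (sg_adj G) ->
  (forall x : sg_vtx G, (0 < deg x)%N) -> (nverts G <= k * nedges G + c)%N ->
  let H := iter_subdiv k r G in
  [/\ symmetric (sg_adj H), irreflexive (sg_adj H),
      forall x : sg_vtx H, (0 < deg x)%N & (nverts H <= k * nedges H + c)%N].
Proof.
move=> k0 symG irrG dG le; elim: r => [|r [symH irrH dH leH]] //=.
split; [exact: subdiv_sym | exact: subdiv_irr | exact: subdiv_deg_gt0 |].
rewrite nverts_subdiv // nedges_subdiv //.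
move: (nverts _) (nedges _) leH => n m leH.
have : (k * m <= k * (k * m))%N by rewrite leq_pmull.
lia.
Qed.

Lemma iter_subdiv_bipartite k r G :
  bipartite (sg_adj G) -> bipartite (sg_adj (iter_subdiv k r G)).
Proof. by move=> b; elim: r => //= r; exact: subdiv_bipartite. Qed.

Lemma nverts_iter_subdiv_gt0 k r G :
  (0 < nverts G)%N -> (0 < nverts (iter_subdiv k r G))%N.
Proof.
move=> n0; elim: r => //= r IH.
by rewrite /nverts card_sum addn_gt0 -/(nverts _) IH.
Qed.

Lemma spectrum_root (C : numClosedFieldType) G (s : seq C) (a : C) :
  nlap_spectrum G s -> root (char_poly (nlap C G)) a -> a \in s.
Proof. by move=> ->; rewrite root_prod_XsubC. Qed.

Lemma gunion_perm (C : numClosedFieldType) (s t : seq C) : perm_eq s t ->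
  \prod_(z <- gunion s) ('X - z%:P) = \prod_(z <- gunion t) ('X - z%:P).
Proof. by move=> st; rewrite /gunion !big_flatten !big_map; exact: perm_big. Qed.

Lemma prod_nseq_XsubC (C : numClosedFieldType) n (a : C) :
  \prod_(z <- nseq n a) ('X - z%:P) = ('X - a%:P) ^+ n.
Proof. by rewrite big_nseq; elim: n => //= n ->; rewrite exprS. Qed.

(** The eigenvalue 0 supplies the square of [X - 3/2] and the eigenvalue 2 that of [X - 1/2].
    Together they raise the exponent of [q] from [k m] to [k m + 2], from which [n] is then
    cancelled. *)
Lemma subdiv_spectrum_0_2 (C : numClosedFieldType) k G (s : seq C) :
  symmetric (sg_adj G) -> irreflexive (sg_adj G) -> (0 < k)%N ->
  (forall x : sg_vtx G, (0 < deg x)%N) -> (nverts G <= k * nedges G + 2)%N ->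
  nlap_spectrum G s -> 0 \in s -> 2%:R \in rem 0 s ->
  nlap_spectrum (subdiv k G)
    (gunion (rem 2%:R (rem 0 s)) ++ [:: 0; 2%:R]
     ++ nseq (k * nedges G + 2 - nverts G) (2%:R^-1)
     ++ nseq (k * nedges G + 2 - nverts G) (3%:R / 2%:R)).
Proof.
move=> symG irrG k0 dG le hs s0 s2.
have := char_poly_subdiv_spectrum C k G s symG irrG k0 dG hs.
rewrite (gunion_perm _ _ _ (perm_to_rem s0)) prod_gunion_cons prod_groots0.
rewrite (gunion_perm _ _ _ (perm_to_rem s2)) prod_gunion_cons prod_groots2.
rewrite /nlap_spectrum !big_cat /= !big_cons big_nil mulr1 !prod_nseq_XsubC subr0.
set P := char_poly _; set Q := \prod_(z <- gunion _) _.
have : 'X - (2%:R^-1)%:P != 0 :> {poly C} by rewrite polyXsubC_eq0.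
have : 'X - (3%:R / 2%:R)%:P != 0 :> {poly C} by rewrite polyXsubC_eq0.
move: ('X - (2%:R^-1)%:P) ('X - (3%:R / 2%:R)%:P) ('X - 2%:P) => q1 q2 x2 q20 q10.
move: (k * nedges G)%N (nverts G) le => K n le PE.
apply: (@mulIf _ ((q1 * q2) ^+ n)); first by rewrite expf_neq0 // mulf_neq0.
have : (q1 * q2) ^+ K * (q1 * q2) ^+ 2 =
       (q1 * q2) ^+ (K + 2 - n) * (q1 * q2) ^+ n by rewrite -!exprD subnK.
rewrite PE -exprMn.
move: ((q1 * q2) ^+ K) ((q1 * q2) ^+ n) ((q1 * q2) ^+ (K + 2 - n)) => qK qn u e.
transitivity (Q * ('X * x2) * (qK * (q1 * q2) ^+ 2)); first by ring.
by rewrite e; ring.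
Qed.

(** Only 0 is split off here, so only [X - 3/2] gains a square; hence the two multiplicities differ
    by 2. *)
Lemma subdiv_spectrum_0 (C : numClosedFieldType) k G (s : seq C) :
  symmetric (sg_adj G) -> irreflexive (sg_adj G) -> (0 < k)%N ->
  (forall x : sg_vtx G, (0 < deg x)%N) -> (nverts G <= k * nedges G)%N ->
  nlap_spectrum G s -> 0 \in s ->
  nlap_spectrum (subdiv k G)
    (gunion (rem 0 s) ++ [:: 0]
     ++ nseq (k * nedges G - nverts G) (2%:R^-1)
     ++ nseq (k * nedges G + 2 - nverts G) (3%:R / 2%:R)).
Proof.
move=> symG irrG k0 dG le hs s0.
have := char_poly_subdiv_spectrum C k G s symG irrG k0 dG hs.
rewrite (gunion_perm _ _ _ (perm_to_rem s0)) prod_gunion_cons prod_groots0.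
rewrite /nlap_spectrum !big_cat /= !big_cons big_nil mulr1 !prod_nseq_XsubC subr0.
set P := char_poly _; set Q := \prod_(z <- gunion _) _.
have : 'X - (2%:R^-1)%:P != 0 :> {poly C} by rewrite polyXsubC_eq0.
have : 'X - (3%:R / 2%:R)%:P != 0 :> {poly C} by rewrite polyXsubC_eq0.
move: ('X - (2%:R^-1)%:P) ('X - (3%:R / 2%:R)%:P) => q1 q2 q20 q10.
move: (k * nedges G)%N (nverts G) le => K n le PE.
apply: (@mulIf _ ((q1 * q2) ^+ n)); first by rewrite expf_neq0 // mulf_neq0.
(* This relies on [n <= K], since natural subtraction truncates. *)
have -> : (K + 2 - n = K - n + 2)%N by lia.
have : (q1 * q2) ^+ K = q1 ^+ (K - n) * q2 ^+ (K - n) * (q1 * q2) ^+ n.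
  by rewrite -exprMn -exprD subnK.
by rewrite PE => ->; rewrite [q2 ^+ (_ + 2)]exprD; ring.
Qed.

(** [nlap_spectrum] determines [s] up to order, so any listing of the eigenvalues of [H] serves, and
    [rem] drops one copy. Connectedness with at least two vertices excludes isolated vertices, and
    none of the natural subtractions truncates in its case. *)
Theorem theorem5p1 (C : numClosedFieldType) (T : finType) (e : rel T)
    (k r : nat) :
  simple_graph e -> connected_graph e -> (2 <= #|T|)%N ->
  (1 <= k)%N -> (1 <= r)%N ->
  let G := SGraph e in
  let H := iter_subdiv k r.-1 G in
  forall s : seq C, nlap_spectrum H s ->
    (bipartite e ->
      nlap_spectrum (iter_subdiv k r G)
        (gunion (rem 2 (rem 0 s)) ++ [:: 0; 2]
         ++ nseq (k * nedges H + 2 - nverts H) (2^-1)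
         ++ nseq (k * nedges H + 2 - nverts H) (3 / 2)))
    /\
    (~ bipartite e ->
      nlap_spectrum (iter_subdiv k r G)
        (gunion (rem 0 s) ++ [:: 0]
         ++ nseq (k * nedges H - nverts H) (2^-1)
         ++ nseq (k * nedges H + 2 - nverts H) (3 / 2))).
Proof.
case=> sym irr conn T2 k0; case: r => // r _ G; cbv zeta; rewrite [r.+1.-1]/=.
set H := iter_subdiv k r G => s hs.
have dG (x : sg_vtx G) : (0 < deg x)%N.
  have /card_gt0P[y] : (0 < #|[set~ x]|)%N.
    by rewrite cardsC1; case: #|T| T2 => [|[]].
  rewrite !inE => yx; have /connectP[[|z p] /=] := conn x y.
    by move=> _ yE; rewrite yE eqxx in yx.
  by case/andP=> exz _ _; apply/card_gt0P; exists z; rewrite inE.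
have [tree cyc] := connected_card_edges _ _ sym irr conn.
have mk : (nedges G <= k * nedges G)%N by rewrite leq_pmull.
have le1 : (nverts G <= k * nedges G + 2)%N.
  rewrite /nverts /= -[#|T|]addn0; apply: leq_trans (leq_add tree (leqnn 0)) _.
  by move: mk; rewrite /nedges /=; lia.
have [symH irrH dH leH] := iter_subdiv_invariants k r G 2 k0 sym irr dG le1.
rewrite -/H in symH irrH dH leH.
have nH : (0 < nverts H)%N by apply: nverts_iter_subdiv_gt0; apply: ltnW T2.
have s0 : 0 \in s.
  apply: spectrum_root hs _; rewrite -(subrr 1).
  by apply: (@root_char_poly_nlap _ _ (fun=> 1)) => // *; rewrite ?oner_eq0 ?mulr1.
split=> [bip|nbip].
- apply: subdiv_spectrum_0_2 => //.
  have : 2%:R \in s.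
    have [f hf] := iter_subdiv_bipartite k r G bip.
    apply: spectrum_root hs _.
    have -> : 2%:R = 1 - -1 :> C by rewrite opprK.
    apply: (@root_char_poly_nlap _ _ (fun x => (-1) ^+ f x)) => // [x|x y /hf].
      by rewrite signr_eq0.
    by case: (f x) (f y) => -[] //= _; rewrite ?expr0 ?expr1 ?mulN1r ?opprK ?mulr1.
  by rewrite (perm_mem (perm_to_rem s0)) inE pnatr_eq0.
- apply: subdiv_spectrum_0 => //.
  have le0 : (nverts G <= k * nedges G + 0)%N.
    by rewrite addn0; apply: leq_trans (cyc nbip) mk.
  have [_ _ _] := iter_subdiv_invariants k r G 0 k0 sym irr dG le0.
  by rewrite addn0.
Qed.
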